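(* Let $k$ be a positive integer and suppose $\frac{k}{k+1}<p\le\frac{k+1}{k+2}<t\le 1$. Then bold play is optimal, i.e. $\pi(p,t)=p$ (attained by $c_1=1$, $c_i=0$ for $i\ge 2$).
   Context: Let $\beta_1,\beta_2,\ldots$ be independent Bernoulli random variables with success probability $p$. A stake sequence is a sequence $\gamma=(c_1,c_2,\ldots)$ of non-negative reals with $c_1\ge c_2\ge\cdots$ and $\sum_i c_i=1$; write $S_\gamma=\sum_i c_i\beta_i$. For $0\le p\le t\le 1$ define $\pi(p,t)=\sup\{\mathbf P(S_\gamma\ge t)\mid \gamma \text{ a stake sequence}\}$. Bold play for threshold $t$ is the stake sequence with $c_i=\frac1m$ for $i\le m$ and $c_i=0$ for $i>m$, where $m=\lfloor 1/t\rfloor$; bold play is optimal if it attains $\pi(p,t)$. For $t>\frac12$ bold play is $c_1=1$, with success probability $p$. *)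

(* Defs.v *)
From HB Require Import structures.
From mathcomp Require Import all_boot all_order all_algebra.
From mathcomp Require Import all_classical all_reals all_analysis.
Set Implicit Arguments. Unset Strict Implicit. Unset Printing Implicit Defensive.
Import Order.TTheory GRing.Theory Num.Theory.
Local Open Scope classical_set_scope.
Local Open Scope ring_scope.

Definition indep_bernoulli_seq {R : realType} {d : measure_display}
  {T : measurableType d} (P : probability T R) (p : R) (beta : nat -> T -> R) : Prop :=
  (forall i, measurable_fun setT (beta i)) /\
  (forall i w, beta i w = 0 \/ beta i w = 1) /\
  (forall i, P (beta i @^-1` [set 1]) = p%:E) /\
  (forall (F : seq nat) (B : nat -> set R), uniq F -> (forall i, measurable (B i)) ->
     P (\bigcap_(i in [set` F]) (beta i @^-1` B i))
     = (\prod_(i <- F) P (beta i @^-1` B i))%E).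

Definition stake_seq {R : realType} (c : nat -> R) : Prop :=
  (forall i, 0 <= c i) /\ (forall i, c i.+1 <= c i) /\
  (\sum_(0 <= i <oo) (c i)%:E = 1%E)%E.

Definition S_gamma {R : realType} {T : Type} (c : nat -> R) (beta : nat -> T -> R)
  (w : T) : \bar R :=
  (\sum_(0 <= i <oo) (c i * beta i w)%:E)%E.

Definition win_prob {R : realType} {d : measure_display} {T : measurableType d}
  (P : probability T R) (beta : nat -> T -> R) (c : nat -> R) (t : R) : \bar R :=
  P [set w | (t%:E <= S_gamma c beta w)%E].

Definition pi_val {R : realType} {d : measure_display} {T : measurableType d}
  (P : probability T R) (beta : nat -> T -> R) (t : R) : \bar R :=
  ereal_sup [set win_prob P beta c t | c in stake_seq].

(* bold play for t > 1/2: c_1 = 1, c_i = 0 for i >= 2 *)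
Definition bold_single {R : realType} (i : nat) : R := if i == 0%N then 1 else 0.

(* Main.v *)
(* Put r = k + 2 and q = (r-1)/r, so p <= q < t. A winning set of coins has
   stake weight > q, so r winning sets always share a coin. Colouring the coins
   uniformly with r colours and letting each of r players miss the coins of one
   colour, not all r players can win; hence the winning probability at bias q is
   at most (r-1)/r = q. The winning event is monotone, so convexity of x^s gives
   by induction on the coins P_{q^s}(win) <= P_q(win)^s for s >= 1; choosing s
   with q^s = p yields P_p(win) <= q^s = p. Since q < t is strict, an infinite
   stake sequence may be truncated, its tail being absorbed in the threshold. *)
Require Import Defs.
From HB Require Import structures.
From mathcomp Require Import all_boot all_order all_algebra ring lra.
From mathcomp Require Import all_classical all_reals all_analysis.
Import Order.TTheory GRing.Theory Num.Theory.
Local Open Scope classical_set_scope.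
Local Open Scope ring_scope.

(** * Tail probabilities of finite stake sums *)

(* [P(S >= t)] for the stakes [cs] and independent coins of bias [p]. *)
Fixpoint bernoulli_tail {R : realType} (p : R) (cs : seq R) (t : R) : R :=
  if cs is c :: cs' then
    (1 - p) * bernoulli_tail p cs' t + p * bernoulli_tail p cs' (t - c)
  else (t <= 0)%R%:R.

Lemma bernoulli_tail_ge0 {R : realType} (p : R) cs t :
  0 <= p <= 1 -> 0 <= bernoulli_tail p cs t.
Proof.
move=> /andP[p0 p1]; elim: cs t => [|c cs IH] t /=; first by rewrite ler0n.
by rewrite addr_ge0 // mulr_ge0 // subr_ge0.
Qed.

Lemma bernoulli_tail_nincr {R : realType} (p : R) cs s t :
  0 <= p <= 1 -> s <= t -> bernoulli_tail p cs t <= bernoulli_tail p cs s.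
Proof.
move=> /andP[p0 p1]; elim: cs s t => [|c cs IH] s t st /=.
  by rewrite ler_nat; case: (lerP t 0) => // /(le_trans st) ->.
apply: lerD; apply: ler_wpM2l; rewrite ?subr_ge0 //; apply: IH => //.
by rewrite lerD2r.
Qed.

(** * The colouring bound at bias [(r-1)/r] *)

Lemma sum_ord_neq {R : nzRingType} (r : nat) (j : 'I_r) (x : R) :
  \sum_(i < r | i != j) x = (r%:R - 1) * x.
Proof.
have := sumr_const 'I_r x; rewrite card_ord (bigD1 j) //= => h.
by rewrite mulrBl mul1r mulr_natl -h addrAC subrr add0r.
Qed.

(* Realise a coin of bias [(r-1)/r] by a uniform colour [l < r], the coin failing
   in coordinate [l] only: each stake is lost in exactly one of the [r]
   coordinates, so the total of the thresholds rules out winning in all of them. *)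
Lemma sum_bernoulli_tail_le {R : realType} (r : nat) (cs : seq R) (t : 'I_r -> R) :
  (0 < r)%N -> (r%:R - 1) * (\sum_(c <- cs) c) < \sum_j t j ->
  \sum_j bernoulli_tail ((r%:R - 1) / r%:R) cs (t j) <= r%:R - 1.
Proof.
move=> r0; have rR0 : r%:R != 0 :> R by rewrite pnatr_eq0 -lt0n.
set q := (r%:R - 1) / r%:R.
elim: cs t => [|c cs IH] t.
  rewrite big_nil mulr0 => st.
  have [j tj] : exists j, 0 < t j.
    apply: contrapT => /forallNP nt; move: st; apply/negP; rewrite -leNgt.
    by apply: sumr_le0 => j _; rewrite leNgt; apply/negP/nt.
  rewrite (bigD1 j) //= [t j <= 0]leNgt tj /= add0r.
  apply: (@le_trans _ _ (\sum_(i < r | i != j) 1)).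
    by apply: ler_sum => i _; case: (t i <= 0).
  by rewrite sum_ord_neq mulr1.
rewrite big_cons /= => st.
(* If the coin has colour [l], coordinate [l] loses it and every other threshold drops by [c]; the
   total drops by [(r-1) * c], as the induction hypothesis requires. *)
pose u (l j : 'I_r) := t j - (if j == l then 0 else c).
have su l : \sum_j u l j = \sum_j t j - (r%:R - 1) * c.
  rewrite /u sumrB; congr (_ - _); rewrite (bigD1 l) //= eqxx add0r.
  rewrite (eq_bigr (fun=> c)); last by move=> j /negbTE ->.
  by rewrite sum_ord_neq.
have H l : \sum_j bernoulli_tail q cs (u l j) <= r%:R - 1.
  by apply: IH; rewrite su; lra.
(* Average over [l]: coordinate [j] loses the coin for one colour and wins it for the other [r - 1],
   which gives the weights [1 - q] and [q]. *)
suff -> : \sum_j ((1 - q) * bernoulli_tail q cs (t j)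
                  + q * bernoulli_tail q cs (t j - c))
   = r%:R^-1 * \sum_l \sum_j bernoulli_tail q cs (u l j).
  rewrite mulrC ler_pdivrMr ?ltr0n //.
  apply: le_trans (ler_sum _ (fun l _ => H l)) _.
  by rewrite sumr_const card_ord mulr_natr.
rewrite exchange_big /= mulr_sumr; apply: eq_bigr => j _.
rewrite (bigD1 j) //= /u eqxx subr0.
rewrite (eq_bigr (fun=> bernoulli_tail q cs (t j - c))); last first.
  by move=> l; rewrite eq_sym => /negbTE ->.
rewrite sum_ord_neq /q; field.
by rewrite rR0.
Qed.

(** * Comparison of different biases *)

(** With [z = (1-p)a + pb], the pairs [{a, pb}] and [{pa, z}] have equal sums and the first lies
    between the members of the second, so convexity of [x^s] gives
    [a^s + (pb)^s <= (pa)^s + z^s]. *)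
Lemma powR_majorization {R : realType} (s a b p : R) :
  1 <= s -> 0 <= a -> a <= b -> 0 <= p <= 1 ->
  (1 - p `^ s) * a `^ s + p `^ s * b `^ s <= ((1 - p) * a + p * b) `^ s.
Proof.
move=> s1 a0 ab /andP[p0 p1]; have b0 := le_trans a0 ab.
set z := (1 - p) * a + p * b.
have uz : p * a <= z by rewrite /z; nra.
rewrite mulrBl mul1r -!powRM // -addrA addrC -addrA.
(* In the degenerate case the interval from [pa] to [z] is a point and the denominator of [l]
   vanishes. *)
have [eq|ne] := eqVneq (p * a) z.
  have az : a = z by move: eq; rewrite /z => eq; nra.
  have bz : p * b = z by move: eq az; rewrite /z; lra.
  rewrite eq bz -az; lra.
have uz' : 0 < z - p * a by rewrite subr_gt0 lt_neqAle ne.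
(* Barycentric weight of [pb] in [[pa, z]]; since the sums agree, [a] has the complementary
   weight. *)
pose l := (z - p * b) / (z - p * a).
have zb : 0 <= z - p * b by rewrite /z addrK mulr_ge0 // subr_ge0.
have l0 : 0 <= l by rewrite divr_ge0 // ltW.
have l1 : l <= 1 by rewrite ler_pdivrMr // mul1r lerD2l lerN2 ler_wpM2l.
have h1 : p * b = l * (p * a) + (1 - l) * z by rewrite /l /z; field; rewrite -/z gt_eqF.
have h2 : a = (1 - l) * (p * a) + l * z by rewrite /l /z; field; rewrite -/z gt_eqF.
have cvx m : 0 <= m -> m <= 1 -> (m * (p * a) + (1 - m) * z) `^ s
    <= m * (p * a) `^ s + (1 - m) * z `^ s.
  move=> m0 m1.
  apply: (convex_powR s1 (Itv01 m0 m1)) => //=; rewrite ?inE /= in_itv /= andbT.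
    exact: mulr_ge0.
  by rewrite (le_trans _ uz) // mulr_ge0.
have := cvx _ l0 l1; rewrite -h1.
have := cvx (1 - l); rewrite subKr -h2 subr_ge0 => /(_ l1).
rewrite gerBl => /(_ l0); lra.
Qed.

(** Induction on the coins: a non-negative stake makes winning at least as likely after a success,
    so [powR_majorization] applies to the two conditional probabilities. *)
Lemma bernoulli_tail_powR {R : realType} (p s : R) (cs : seq R) (t : R) :
  1 <= s -> 0 <= p <= 1 -> all (>= 0) cs ->
  bernoulli_tail (p `^ s) cs t <= (bernoulli_tail p cs t) `^ s.
Proof.
move=> s1 p01; have s0 : s != 0 by rewrite gt_eqF // (lt_le_trans ltr01).
have ps01 : 0 <= p `^ s <= 1.
  case/andP: p01 => p0 p1; rewrite powR_ge0 /=; have <- : 1 `^ s = 1 :> R by rewrite powR1.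
  by apply: ge0_ler_powR => //; rewrite ?nnegrE //; lra.
case/andP: (ps01) => ps0 ps1.
elim: cs t => [|c cs IH] t /=; first by case: (t <= 0); rewrite ?powR0 ?powR1.
case/andP => c0 /IH {}IH.
have tt : bernoulli_tail p cs t <= bernoulli_tail p cs (t - c).
  by apply: bernoulli_tail_nincr => //; rewrite gerBl.
have := @powR_majorization _ s _ _ p s1 (bernoulli_tail_ge0 _ _ _ p01) tt p01.
apply: le_trans.
by apply: lerD; apply: ler_wpM2l; rewrite ?subr_ge0.
Qed.

Lemma bernoulli_tail_le {R : realType} (k : nat) (p t : R) (cs : seq R) :
  0 < p -> p <= k.+1%:R / k.+2%:R -> k.+1%:R / k.+2%:R < t ->
  all (>= 0) cs -> \sum_(c <- cs) c <= 1 ->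
  bernoulli_tail p cs t <= p.
Proof.
move=> p0 pq qt cs0 cs1; set q := _ / _ in pq qt.
have q0 : 0 < q by rewrite divr_gt0 ?ltr0n.
have q1 : q < 1 by rewrite ltr_pdivrMr ?ltr0n // mul1r ltr_nat.
have tq : bernoulli_tail q cs t <= q.
  have sumE (x : R) : \sum_(j < k.+2) x = k.+2%:R * x.
    by rewrite sumr_const card_ord mulr_natl.
  have r1 : k.+2%:R - 1 = k.+1%:R :> R by rewrite -[k.+2%:R]natr1 addrK.
  (* All [k.+2] coordinates get the same threshold [t]; the condition on totals then follows from
     [q < t] and total stake at most 1. *)
  have /= := @sum_bernoulli_tail_le R k.+2 cs (fun=> t) isT.
  rewrite !sumE r1 -/q -ler_pdivlMl ?ltr0n // [X in _ <= X]mulrC; apply.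
  move: qt; rewrite /q ltr_pdivrMr ?ltr0n // [t * _]mulrC.
  by apply: le_lt_trans; rewrite ler_piMr.
(* The solution of [q^s = p]; both logarithms are negative, so [p <= q] gives [s >= 1]. *)
pose s := ln p / ln q.
have lnq : ln q < 0 by apply: ln_lt0; rewrite q0.
have s1 : 1 <= s by rewrite /s ler_ndivlMr // mul1r ler_ln.
have ps : p = q `^ s.
  by rewrite /powR gt_eqF // /s divfK ?lt_eqF // lnK.
have q01 : 0 <= q <= 1 by rewrite !ltW.
have sq : (bernoulli_tail q cs t) `^ s <= q `^ s.
  apply: ge0_ler_powR; rewrite ?nnegrE ?(ltW q0) //; first lra.
  exact: bernoulli_tail_ge0.
by have := le_trans (bernoulli_tail_powR _ _ _ t s1 q01 cs0) sq; rewrite -ps.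
Qed.

(** * The law of a finite stake sum *)

Lemma bernoulli0_prob {R : realType} {d : measure_display} {T : measurableType d}
    (P : probability T R) (p : R) (beta : nat -> T -> R) i :
  indep_bernoulli_seq P p beta -> P (beta i @^-1` [set 0]) = (1 - p)%:E.
Proof.
move=> [mb [b01 [Pb _]]].
have -> : beta i @^-1` [set 0] = ~` (beta i @^-1` [set 1]).
  apply/seteqP; split => w /=; first by move=> ->; apply/eqP; rewrite eq_sym oner_eq0.
  by case: (b01 i w).
rewrite probability_setC ?Pb // -[X in measurable X]setTI.
by apply: mb => //; exact: measurable_set1.
Qed.

Lemma measurable_stake_sum {R : realType} {d : measure_display}
    {T : measurableType d} (beta : nat -> T -> R) (c : nat -> R) (s : seq nat) (t : R) :
  (forall i, measurable_fun setT (beta i)) ->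
  measurable [set w | t <= \sum_(i <- s) c i * beta i w].
Proof.
move=> mb; rewrite -[X in measurable X]setTI.
apply: (@measurable_fun_le _ _ _ _ (cst t)) => //.
by apply: measurable_sum => i; exact: measurable_realfun.measurable_funM.
Qed.

(* Conditioning on the first [m] coins makes the induction on [n] go through
   with only the product rule for finite families. *)
Lemma prob_cylinder_stake_sum {R : realType} {d : measure_display}
    {T : measurableType d} (P : probability T R) (p : R) (beta : nat -> T -> R)
    (c : nat -> R) (n m : nat) (B : nat -> set R) (t : R) :
  indep_bernoulli_seq P p beta -> (forall i, measurable (B i)) ->
  P ((\bigcap_(i in [set` iota 0 m]) (beta i @^-1` B i)) `&`
     [set w | t <= \sum_(i <- iota m n) c i * beta i w])
  = (P (\bigcap_(i in [set` iota 0 m]) (beta i @^-1` B i)) *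
     (bernoulli_tail p (map c (iota m n)) t)%:E)%E.
Proof.
move=> ib; elim: n m B t => [|n IH] m B t mB.
  rewrite /=; case: (boolP (t <= 0)) => t0; rewrite ?mule1 ?mule0.
    by congr (P _); apply/setIidPl => w _; rewrite /= big_nil.
  rewrite [X in P X](_ : _ = set0) ?measure0 //.
  by apply/seteqP; split => w // -[_] /=; rewrite big_nil (negbTE t0).
have [mb [b01 [Pb ind]]] := ib.
(* Pinning coin [m] to [x] turns each outcome of that coin into a cylinder on [m.+1] coins, to which
   the induction hypothesis applies. *)
pose Bx x i := if i == m then [set x] else B i : set R.
have mBx x i : measurable (Bx x i).
  by rewrite /Bx; case: (i == m) => //; exact: measurable_set1.
pose A := \bigcap_(i in [set` iota 0 m]) (beta i @^-1` B i).
pose Ax x := \bigcap_(i in [set` iota 0 m.+1]) (beta i @^-1` Bx x i).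
have AxE x : Ax x = A `&` (beta m @^-1` [set x]).
  rewrite /Ax -addn1 iotaD add0n /= !bigcap_seq big_cat big_seq1 /= /Bx eqxx.
  rewrite /A bigcap_seq; congr (_ `&` _).
  apply: eq_big_seq => i; rewrite mem_iota add0n /= => im.
  by rewrite ltn_eqF.
have PAx x : P (Ax x) = (P A * P (beta m @^-1` [set x]))%E.
  rewrite /Ax /A !ind ?iota_uniq // -addn1 iotaD add0n big_cat big_seq1 /= /Bx eqxx.
  congr (_ * _)%E; apply: eq_big_seq => i; rewrite mem_iota add0n /= => im.
  by rewrite ltn_eqF.
have mAx x : measurable (Ax x).
  apply: bigcap_measurableType => i _; rewrite -[X in measurable X]setTI.
  exact: mb.
rewrite -/A /=.
pose E (s : R) := [set w | s <= \sum_(i <- iota m.+1 n) c i * beta i w].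
have -> : A `&` [set w | t <= \sum_(i <- m :: iota m.+1 n) c i * beta i w]
    = (Ax 0 `&` E t) `|` (Ax 1 `&` E (t - c m)).
  rewrite !AxE; apply/seteqP; split => w /=.
    rewrite big_cons => -[Aw tw]; have [b|b] := b01 m w; [left|right];
      move: tw; rewrite b ?mulr0 ?add0r ?mulr1 => tw; split=> //.
    by rewrite /E /= lerBlDl.
  rewrite big_cons; case=> -[[Aw ->]]; rewrite ?mulr0 ?add0r ?mulr1 //.
  by rewrite /E /= lerBlDl.
have -> : P ((Ax 0 `&` E t) `|` (Ax 1 `&` E (t - c m)))
    = (P (Ax 0%R `&` E t) + P (Ax 1%R `&` E (t - c m)%R))%E.
  rewrite measureU //; try by apply: measurableI => //; exact: measurable_stake_sum.
  apply/seteqP; split => w //=; rewrite !AxE => -[[[_ /= ->] _] [[_ /= /eqP]]].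
  by rewrite eq_sym oner_eq0.
have PAxE x (s : R) : P (Ax x `&` E s)
    = (P (Ax x) * (bernoulli_tail p (map c (iota m.+1 n)) s)%:E)%E.
  exact: IH.
rewrite !PAxE !PAx Pb (bernoulli0_prob _ _ _ _ ib).
rewrite -!muleA -!EFinM -muleDr //.
apply: fin_num_measure; apply: bigcap_measurableType => i _.
by rewrite -[X in measurable X]setTI; exact: mb.
Qed.

Lemma prob_stake_sum {R : realType} {d : measure_display}
    {T : measurableType d} (P : probability T R) (p : R) (beta : nat -> T -> R)
    (c : nat -> R) (n : nat) (t : R) :
  indep_bernoulli_seq P p beta ->
  P [set w | t <= \sum_(i <- iota 0 n) c i * beta i w]
  = (bernoulli_tail p (map c (iota 0 n)) t)%:E.
Proof.
move=> ib; have := prob_cylinder_stake_sum P p beta c n 0 (fun=> setT) t ib (fun=> measurableT).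
by rewrite bigcap_seq big_nil setTI probability_setT mul1e.
Qed.

(** * Truncation of infinite stake sequences *)

(** Coins from index [n] on contribute at most their stakes, whose total is 1 minus the first [n]
    stakes. *)
Lemma S_gamma_le {R : realType} {T : Type} (c : nat -> R) (beta : nat -> T -> R)
    (n : nat) w :
  (forall i, 0 <= beta i w <= 1) -> stake_seq c ->
  (S_gamma c beta w <=
   (\sum_(i <- iota 0 n) c i * beta i w + (1 - \sum_(i <- iota 0 n) c i))%:E)%E.
Proof.
move=> b01 [c0 [_ cs]].
have cb0 i : (0 <= (c i * beta i w)%:E)%E.
  by rewrite lee_fin mulr_ge0 //; case/andP: (b01 i).
have index : iota 0 n = index_iota 0 n by rewrite /index_iota subn0.
have tail : (\sum_(n <= i <oo) (c i)%:E = (1 - \sum_(i <- iota 0 n) c i)%:E)%E.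
  have := nneseries_split 0 n (fun i _ => c0 i : (0 <= (c i)%:E)%E).
  rewrite add0n cs sumEFin -index EFinB => ->.
  by rewrite addeAC subee ?add0e.
rewrite /S_gamma (nneseries_split 0 n) // add0n sumEFin -index EFinD leeD2l //.
rewrite -tail; apply: lee_nneseries => // i _.
by rewrite lee_fin ler_piMr //; case/andP: (b01 i).
Qed.

Lemma measurable_S_gamma {R : realType} {d : measure_display}
    {T : measurableType d} (c : nat -> R) (beta : nat -> T -> R) t :
  (forall i, measurable_fun setT (beta i)) ->
  (forall i w, 0 <= c i * beta i w) ->
  measurable [set w | (t <= S_gamma c beta w)%E].
Proof.
move=> mb cb0; rewrite -[X in measurable X]setTI.
apply: measurable_realfun.emeasurable_fun_c_infty => //.
apply: (@ge0_emeasurable_sum _ _ _ _ (fun i w => (c i * beta i w)%:E) xpredT).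
  by move=> i w _ _; rewrite lee_fin.
move=> i _; apply/measurable_realfun.measurable_EFinP.
exact: measurable_realfun.measurable_funM.
Qed.

Lemma win_prob_le {R : realType} {d : measure_display}
    {T : measurableType d} (P : probability T R) (p t : R) (beta : nat -> T -> R)
    (c : nat -> R) (k : nat) :
  indep_bernoulli_seq P p beta -> stake_seq c ->
  0 < p -> p <= k.+1%:R / k.+2%:R -> k.+1%:R / k.+2%:R < t ->
  (win_prob P beta c t <= p%:E)%E.
Proof.
move=> ib sc p0 pq qt; have [mb [b01 _]] := ib; have [c0 [_ cs]] := sc.
have beta01 i w : 0 <= beta i w <= 1 by case: (b01 i w) => ->; rewrite lexx ler01.
have csum n : (\sum_(i <- iota 0 n) c i)%:E = (\sum_(0 <= i < n) (c i)%:E)%E.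
  by rewrite sumEFin /index_iota subn0.
have sum_le1 n : \sum_(i <- iota 0 n) c i <= 1.
  rewrite -lee_fin csum -cs; apply: nneseries_lim_ge => i _ _; exact: c0.
(* Otherwise all partial sums, and so their limit 1, would stay below 1 by the positive gap between
   [t] and the bias bound. *)
have [n hn] : exists n, 1 - \sum_(i <- iota 0 n) c i < t - k.+1%:R / k.+2%:R.
  apply: contrapT => /forallNP nn.
  have : (1%:E <= (1 - (t - k.+1%:R / k.+2%:R))%:E)%E.
    rewrite -cs; apply: lime_le; first by apply: is_cvg_nneseries => i _ _; exact: c0.
    apply: nearW => n; rewrite -csum lee_fin.
    have /negP := nn n; rewrite -leNgt => h.
    by rewrite lerBrDr addrC -lerBrDr.
  by rewrite lee_fin lerBrDr gerDl leNgt subr_gt0 qt.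
pose t' := t - (1 - \sum_(i <- iota 0 n) c i).
have qt' : k.+1%:R / k.+2%:R < t' by rewrite /t' ltrBrDr addrC -ltrBrDr.
apply: (@le_trans _ _ (P [set w | t' <= \sum_(i <- iota 0 n) c i * beta i w])).
  apply: le_measure; rewrite ?inE.
  - apply: measurable_S_gamma => // i w; rewrite mulr_ge0 //.
    by case/andP: (beta01 i w).
  - exact: measurable_stake_sum.
  - move=> w /= /le_trans/(_ (S_gamma_le c beta n w (beta01 ^~ w) sc)).
    by rewrite lee_fin /t' lerBlDr.
rewrite (prob_stake_sum _ _ _ _ _ _ ib) lee_fin (bernoulli_tail_le k) //.
  by apply/allP => _ /mapP[i _ ->].
by rewrite big_map.
Qed.

(** * Optimality of bold play *)

Lemma nneseries_single {R : realType} (f : nat -> \bar R) :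
  (0 <= f 0%N)%E -> (forall i, f i.+1 = 0%E) -> (\sum_(0 <= i <oo) f i = f 0%N)%E.
Proof.
move=> f0 fS; rewrite (nneseries_split 0 1).
  by rewrite big_nat1 eseries0 ?adde0 // => -[].
by case=> // i _; rewrite fS.
Qed.

Theorem theorem12 (R : realType) (d : measure_display) (T : measurableType d)
  (P : probability T R) (p t : R) (beta : nat -> T -> R) (k : nat) :
  (0 < k)%N ->
  indep_bernoulli_seq P p beta ->
  k%:R / k.+1%:R < p -> p <= k.+1%:R / k.+2%:R -> k.+1%:R / k.+2%:R < t -> t <= 1 ->
  pi_val P beta t = p%:E /\ win_prob P beta bold_single t = p%:E.
Proof.
move=> k0 ib kp pq qt t1.
have p0 : 0 < p by apply: le_lt_trans kp; rewrite divr_ge0 ?ler0n.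
have t0 : 0 < t by apply: le_lt_trans qt; rewrite divr_ge0 ?ler0n.
have [_ [b01 [Pb _]]] := ib.
(* The stake sum is the first coin, which reaches [t] exactly when it equals 1, because
   [0 < t <= 1]. *)
have bold_win : win_prob P beta bold_single t = p%:E.
  rewrite -(Pb 0%N) /win_prob; congr (P _); apply/seteqP; split => w /=;
    rewrite /S_gamma nneseries_single ?lee_fin ?mul1r //=.
  - by case: (b01 0%N w) => // ->; rewrite leNgt t0.
  - by case: (b01 0%N w) => ->; rewrite ?ler01.
  - by move=> i; rewrite mul0r.
  - by move=> ->.
  - by case: (b01 0%N w) => ->; rewrite ?ler01.
  - by move=> i; rewrite mul0r.
have stake_bold : stake_seq (@bold_single R).
  split; first by case=> [|i]; rewrite /bold_single.
  split; first by case=> [|i]; rewrite /bold_single.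
  by rewrite nneseries_single ?lee_fin.
split=> //; apply/eqP; rewrite eq_le; apply/andP; split.
  apply: ge_ereal_sup => _ [c sc <-]; exact: (win_prob_le _ _ _ _ _ k).
by apply: ereal_sup_ubound; exists bold_single.
Qed.
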